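(* For all integers $n>r>1$, $$\mathrm{ex}_{\to}(n,CM^r)=\mathrm{ex}_{\circlearrowright}(n,CM^r)=\binom{n}{r}-\binom{n-r}{r}.$$
   Context: An ordered (respectively convex geometric) $r$-graph is an $r$-uniform hypergraph whose vertex set is linearly (respectively cyclically) ordered. Containment means containment as a subgraph via an injection preserving the linear (respectively cyclic) ordering of the vertices. $\mathrm{ex}_{\to}(n,F)$ (respectively $\mathrm{ex}_{\circlearrowright}(n,F)$) is the maximum number of edges in an $n$-vertex ordered (respectively convex geometric) $r$-graph that does not contain $F$. The crossing matching $CM^r$ consists of two disjoint edges $\{v_0,v_2,v_4,\dots,v_{2r-2}\}$ and $\{v_1,v_3,\dots,v_{2r-1}\}$ with $v_0<v_1<v_2<\dots<v_{2r-1}$, where $<$ is the linear ordering in the ordered setting and the cyclic ordering in the convex geometric setting. Binomial coefficients $\binom{a}{r}$ with $0\le a<r$ are $0$. *)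

(* Defs.v *)
From mathcomp Require Import all_boot.

Set Implicit Arguments.
Unset Strict Implicit.
Unset Printing Implicit Defensive.

(* A hypergraph on n vertices is identified with its set of edges; the vertex
   set is 'I_n, with its natural linear order 0 < 1 < ... < n-1 in the ordered
   setting, and with the cyclic order induced by it in the convex geometric
   setting. *)
Definition hypergraph (n : nat) : finType := {set {set 'I_n}}.

Definition uniform (r n : nat) (H : hypergraph n) : bool :=
  [forall e in H, #|e| == r].

(* cyclic_lt a b c: going around the circle from a, one meets b strictly before
   c, the three points being distinct. *)
Definition cyclic_lt (n : nat) (a b c : 'I_n) : bool :=
  [|| a < b < c, b < c < a | c < a < b].

Definition linear_embedding (m n : nat) (f : 'I_m -> 'I_n) : bool :=
  injectiveb f && [forall a : 'I_m, forall b : 'I_m, (a < b) ==> (f a < f b)].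

Definition cyclic_embedding (m n : nat) (f : 'I_m -> 'I_n) : bool :=
  injectiveb f &&
  [forall a : 'I_m, forall b : 'I_m, forall c : 'I_m,
     cyclic_lt a b c ==> cyclic_lt (f a) (f b) (f c)].

Definition maps_edges (m n : nat) (f : 'I_m -> 'I_n)
    (F : hypergraph m) (H : hypergraph n) : bool :=
  [forall e in F, (f @: e) \in H].

Definition ord_contains (m n : nat) (F : hypergraph m) (H : hypergraph n) :
    bool :=
  [exists f : {ffun 'I_m -> 'I_n}, linear_embedding f && maps_edges f F H].

Definition cg_contains (m n : nat) (F : hypergraph m) (H : hypergraph n) :
    bool :=
  [exists f : {ffun 'I_m -> 'I_n}, cyclic_embedding f && maps_edges f F H].

(* If F has at least one edge, the edgeless hypergraph does not contain F, so
   the maxima below range over a nonempty family. *)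
Definition ex_ord (r n m : nat) (F : hypergraph m) : nat :=
  \max_(H : hypergraph n | uniform r H && ~~ ord_contains F H) #|H|.

Definition ex_cg (r n m : nat) (F : hypergraph m) : nat :=
  \max_(H : hypergraph n | uniform r H && ~~ cg_contains F H) #|H|.

(* The vertex v_i is the element i of 'I_(2r). *)
Definition crossing_matching (r : nat) : hypergraph (2 * r) :=
  [set [set i : 'I_(2 * r) | ~~ odd i]; [set i : 'I_(2 * r) | odd i]].

(* Main.v *)
Require Import Defs.
From mathcomp Require Import all_boot zify.

Set Implicit Arguments.
Unset Strict Implicit.
Unset Printing Implicit Defensive.

(** Write the vertices of an r-set A as v_0 < ... < v_(r-1) and put v_r = n; call
    A sparse if v_k + 1 < v_(k+1) for all k < r.  Subtracting k from v_k shows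
    that there are 'C(n - r, r) sparse r-sets.  The non-sparse r-sets contain no
    crossing matching: two cyclically consecutive vertices of an edge are
    separated by a vertex of the other edge, so both edges would have to
    contain the last vertex n - 1.

    Conversely let H contain no crossing matching.  For an edge A and i <= r say
    that A is crossed from i on if some B in H has the same first i vertices as A
    and its k-th vertex strictly between v_k and v_(k+1) for i <= k < r.  Every
    edge is crossed from r on and none from 0 on, so there is an i for which A is
    crossed from i + 1 on and not from i on.  Moving v_i to v_(i+1) - 1 is then an
    injection of H into the non-sparse sets: i is the last place where the image
    fails to be sparse, and of two edges which differ only in their i-th vertex
    and are both crossed from i + 1 on, the one with the smaller i-th vertex is
    crossed from i on. *)

(** The sentinel [vertex A #|A| = n] lets the last vertex be treated like the
    others. *)
Definition vertex (n : nat) (A : {set 'I_n}) (i : nat) : nat :=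
  nth n [seq val x | x <- enum A] i.

Definition set_of_fun (n r : nat) (g : nat -> nat) : {set 'I_n} :=
  [set x : 'I_n | val x \in mkseq g r].

Definition sparse (n r : nat) (A : {set 'I_n}) : bool :=
  [forall i : 'I_r, (vertex A i).+1 < vertex A i.+1].

Definition sparse_sets (n r : nat) : hypergraph n :=
  [set A : {set 'I_n} | (#|A| == r) && sparse r A].

Definition nonsparse_sets (n r : nat) : hypergraph n :=
  [set A : {set 'I_n} | (#|A| == r) && ~~ sparse r A].

Definition crossed_from (n r : nat) (H : hypergraph n) (A : {set 'I_n})
    (i : nat) : bool :=
  [exists B in H, [forall k : 'I_r,
     if k < i then vertex B k == vertex A k
     else vertex A k < vertex B k < vertex A k.+1]].

Definition push_vertex (n r : nat) (A : {set 'I_n}) (i : nat) : {set 'I_n} :=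
  set_of_fun n r
    (fun k => if k == i then (vertex A i.+1).-1 else vertex A k).

(** * Vertices in increasing order *)

Lemma sorted_vertices (n : nat) (A : {set 'I_n}) :
  sorted ltn [seq val x | x <- enum A].
Proof.
rewrite {1}/enum_mem -enumT sorted_map; apply: sorted_filter.
  by move=> x y z; apply: ltn_trans.
by rewrite -sorted_map val_enum_ord iota_ltn_sorted.
Qed.

Lemma vertex_card (n : nat) (A : {set 'I_n}) : vertex A #|A| = n.
Proof. by rewrite /vertex nth_default // size_map -cardE. Qed.

Lemma vertex_in (n : nat) (A : {set 'I_n}) (i : nat) :
  i < #|A| -> exists2 x, x \in A & val x = vertex A i.
Proof.
rewrite cardE => lti.
have : vertex A i \in [seq val x | x <- enum A] by rewrite mem_nth ?size_map.
by case/mapP=> x; rewrite mem_enum => xA ->; exists x.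
Qed.

Lemma vertexP (n : nat) (A : {set 'I_n}) (x : 'I_n) :
  x \in A -> exists2 i, i < #|A| & vertex A i = x.
Proof.
move=> xA; have xs : val x \in [seq val y | y <- enum A].
  by rewrite map_f ?mem_enum.
exists (index (val x) [seq val y | y <- enum A]); last by rewrite /vertex nth_index.
by rewrite cardE -(size_map val) index_mem.
Qed.

Lemma vertex_ltS (n : nat) (A : {set 'I_n}) (i : nat) :
  i < #|A| -> vertex A i < vertex A i.+1.
Proof.
move=> ltiA; have [ltSi|leSi] := ltnP i.+1 #|A|.
  move/sortedP: (sorted_vertices A) => /(_ n i); apply.
  by rewrite size_map -cardE.
have [x _ <-] := vertex_in ltiA.
rewrite (_ : i.+1 = #|A|) ?vertex_card ?ltn_ord //.
by apply/eqP; rewrite eqn_leq ltiA.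
Qed.

Lemma ltn_of_step (g : nat -> nat) (r : nat) :
  (forall i, i < r -> g i < g i.+1) ->
  forall i j, i < j -> j <= r -> g i < g j.
Proof.
move=> gS i; elim=> // j IHj; rewrite ltnS leq_eqVlt => /predU1P[->|ltij] lejr.
  exact: gS.
exact: ltn_trans (IHj ltij (ltnW lejr)) (gS _ lejr).
Qed.

(** The condition [g r = n] keeps the values of [g] before [r] below [n], so none is lost in ['I_n];
    it also matches the sentinel. *)
Lemma vertices_set_of_fun (n r : nat) (g : nat -> nat) :
    (forall i, i < r -> g i < g i.+1) -> g r = n ->
  [seq val x | x <- enum (set_of_fun n r g)] = mkseq g r.
Proof.
move=> gS gr; apply: (irr_sorted_eq ltn_trans ltnn).
- exact: sorted_vertices.
- apply/(sortedP 0) => i; rewrite size_mkseq => ltir.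
  by rewrite !nth_mkseq ?gS // ltnW.
move=> x; apply/mapP/idP => [[y]|xg].
  by rewrite mem_enum inE => yg ->.
have ltxn : x < n.
  case/mapP: xg => i; rewrite mem_iota /= => ltir ->.
  by rewrite -gr; apply: (ltn_of_step gS).
by exists (Ordinal ltxn); rewrite // mem_enum inE.
Qed.

Lemma card_set_of_fun (n r : nat) (g : nat -> nat) :
    (forall i, i < r -> g i < g i.+1) -> g r = n ->
  #|set_of_fun n r g| = r.
Proof.
by move=> gS gr; rewrite cardE -(size_map val) vertices_set_of_fun ?size_mkseq.
Qed.

Lemma vertex_set_of_fun (n r : nat) (g : nat -> nat) (i : nat) :
    (forall i, i < r -> g i < g i.+1) -> g r = n -> i <= r ->
  vertex (set_of_fun n r g) i = g i.
Proof.
move=> gS gr; rewrite leq_eqVlt => /predU1P[->|ltir].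
  by rewrite gr -{2}(card_set_of_fun gS gr) vertex_card.
by rewrite /vertex vertices_set_of_fun ?nth_mkseq.
Qed.

Lemma vertex_inj (n r : nat) (A B : {set 'I_n}) :
    #|A| = r -> #|B| = r -> (forall i, i < r -> vertex A i = vertex B i) ->
  A = B.
Proof.
move=> cA cB eqAB; apply/eqP; rewrite eqEcard cA cB leqnn andbT.
apply/subsetP => x xA; have [i] := vertexP xA; rewrite cA => ltir vi.
have [y yB eqy] : exists2 y, y \in B & val y = vertex B i.
  by apply: vertex_in; rewrite cB.
by rewrite (_ : x = y) //; apply: val_inj; rewrite eqy -eqAB.
Qed.

(** * Counting sparse and non-sparse sets *)

Lemma card_sparse_sets (n r : nat) : r <= n -> #|sparse_sets n r| = 'C(n - r, r).
Proof.
move=> lern; pose D := [set B : {set 'I_(n - r)} | #|B| == r].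
pose spread (B : {set 'I_(n - r)}) := set_of_fun n r (fun k => vertex B k + k).
have spreadS (B : {set 'I_(n - r)}) : #|B| = r ->
  forall i, i < r -> (vertex B i + i).+1 < vertex B i.+1 + i.+1.
  move=> cB i ltir; have := @vertex_ltS _ B i; rewrite cB => /(_ ltir); lia.
have spread1 (B : {set 'I_(n - r)}) : #|B| = r ->
  forall i, i < r -> vertex B i + i < vertex B i.+1 + i.+1.
  by move=> cB i ltir; have := spreadS B cB i ltir; lia.
have spreadr (B : {set 'I_(n - r)}) : #|B| = r -> vertex B r + r = n.
  by move=> cB; have := vertex_card B; rewrite cB; lia.
rewrite -[in RHS](card_ord (n - r)) -card_draws -/D.
rewrite -(card_in_imset (f := spread) (D := D)); last first.
  move=> B C; rewrite !inE => /eqP cB /eqP cC eqBC.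
  apply: (vertex_inj cB cC) => i ltir.
  have := congr1 (fun E => vertex E i) eqBC.
  rewrite !vertex_set_of_fun ?spreadr ?(ltnW ltir) //; try exact: spread1.
  by move/addIn.
congr #|pred_of_set _|; apply/setP => A; rewrite inE; apply/andP/imsetP.
  case=> /eqP cA /forallP sA.
  have {}sA i : i < r -> (vertex A i).+1 < vertex A i.+1.
    by move=> ltir; have := sA (Ordinal ltir).
  (* This makes the truncated subtraction in [g] exact. *)
  have leA i : i <= r -> i <= vertex A i.
    by elim: i => // i IHi ltir; have := sA i ltir; have := IHi (ltnW ltir); lia.
  pose g k := vertex A k - k.
  have gS i : i < r -> g i < g i.+1.
    by move=> ltir; have := sA i ltir; have := leA i (ltnW ltir); rewrite /g; lia.
  have gr : g r = n - r by rewrite /g -{1}cA vertex_card.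
  have cB := card_set_of_fun gS gr.
  exists (set_of_fun (n - r) r g); first by rewrite inE cB.
  have sB := spread1 _ cB; have rB := spreadr _ cB.
  apply: (vertex_inj cA (card_set_of_fun sB rB)) => i ltir.
  rewrite vertex_set_of_fun ?(ltnW ltir) // vertex_set_of_fun ?(ltnW ltir) //.
  by rewrite /g subnK ?leA ?(ltnW ltir).
case=> B; rewrite inE => /eqP cB ->.
have sB := spread1 _ cB; have rB := spreadr _ cB.
rewrite card_set_of_fun //; split=> //; apply/forallP => i.
have ltir := ltn_ord i.
by rewrite !vertex_set_of_fun ?(ltnW ltir) ?spreadS.
Qed.

Lemma card_nonsparse_sets (n r : nat) :
  r <= n -> #|nonsparse_sets n r| = 'C(n, r) - 'C(n - r, r).
Proof.
move=> lern; rewrite -(card_sparse_sets lern) -[in 'C(n, r)](card_ord n).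
rewrite -card_draws -cardsDS; last first.
  by apply/subsetP => A; rewrite !inE => /andP[].
congr #|pred_of_set _|; apply/setP => A; rewrite !inE.
by case: (#|A| == r); rewrite // andbT.
Qed.

(** * The upper bound in the ordered setting *)

Lemma crossed_from0_contains (n r : nat) (H : hypergraph n) (A : {set 'I_n}) :
    uniform r H -> A \in H -> crossed_from r H A 0 ->
  ord_contains (crossing_matching r) H.
Proof.
move=> /forall_inP uH AH /exists_inP[B BH /forallP crAB].
have cA := eqP (uH _ AH); have cB := eqP (uH _ BH).
have {}crAB k : k < r -> vertex A k < vertex B k < vertex A k.+1.
  by move=> ltkr; have := crAB (Ordinal ltkr).
(* The vertices interleave, [A] giving the even positions and [B] the odd ones; position [2 * r] is
   the sentinel of [A]. *)
pose g j := if odd j then vertex B j./2 else vertex A j./2.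
have gS j : j < 2 * r -> g j < g j.+1.
  move=> ltj; have ltj2 : j./2 < r by lia.
  have := crAB _ ltj2; rewrite /g /= uphalf_half.
  by case: (odd j) => /= /andP[? ?].
have gr : g (2 * r) = n.
  rewrite /g mul2n odd_double doubleK.
  by rewrite -cA vertex_card.
have ltgn (j : 'I_(2 * r)) : g j < n.
  by rewrite -gr; apply: (ltn_of_step gS).
pose f := [ffun j : 'I_(2 * r) => Ordinal (ltgn j)].
have fE j : f j = g j :> nat by rewrite ffunE.
have fmono (a b : 'I_(2 * r)) : a < b -> f a < f b.
  by move=> ltab; rewrite !fE (ltn_of_step gS) // ltnW.
apply/existsP; exists f; apply/andP; split.
  apply/andP; split; last by apply/forallP=> a; apply/forallP=> b; apply/implyP/fmono.
  apply/injectiveP => a b eqf; apply: val_inj.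
  by case: (ltngtP a b) => // /fmono; rewrite eqf ltnn.
have imf (b : bool) (C : {set 'I_n}) : #|C| = r ->
    (forall j, odd j = b -> g j = vertex C j./2) ->
  f @: [set j : 'I_(2 * r) | odd j == b] = C.
  move=> cC gC; apply/setP => x; apply/imsetP/idP => [[j]|xC].
    rewrite inE => /eqP oj ->.
    have [|y yC eqy] := @vertex_in _ C j./2; first by have := ltn_ord j; lia.
    by rewrite (_ : f j = y) //; apply: val_inj; rewrite eqy [LHS]fE gC.
  have [i] := vertexP xC; rewrite cC => ltir vi.
  have ltj : b + i.*2 < 2 * r by case: (b); lia.
  have oj : odd (b + i.*2) = b by rewrite oddD odd_double addbF oddb.
  exists (Ordinal ltj); first by rewrite inE /= oj.
  by apply: val_inj; rewrite [RHS]fE gC // half_bit_double vi.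
apply/forall_inP => e; rewrite !inE => /orP[]/eqP->.
  rewrite (_ : [set _ | _] = [set j : 'I_(2 * r) | odd j == false]).
    by rewrite (imf false A) // => j oj; rewrite /g oj.
  by apply/setP => j; rewrite !inE eqbF_neg.
rewrite (_ : [set _ | _] = [set j : 'I_(2 * r) | odd j == true]).
  by rewrite (imf true B) // => j oj; rewrite /g oj.
by apply/setP => j; rewrite !inE eqb_id.
Qed.

Lemma exists_crossing_index (n r : nat) (H : hypergraph n) (A : {set 'I_n}) :
    A \in H -> ~~ crossed_from r H A 0 ->
  exists i : 'I_r, crossed_from r H A i.+1 && ~~ crossed_from r H A i.
Proof.
move=> AH nA0.
(* From [r] on no strict inequality remains, so [A] is its own witness. *)
have Ar : crossed_from r H A r.
  by apply/exists_inP; exists A => //; apply/forallP => k; rewrite ltn_ord.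
have [i Ai mini] := ex_minnP (ex_intro _ r Ar).
case: i Ai mini => [|i] Ai mini; first by rewrite Ai in nA0.
exists (Ordinal (mini r Ar)); rewrite /= Ai /=.
by apply/negP => /mini; rewrite ltnn.
Qed.

Lemma crossed_from_gap (n r : nat) (H : hypergraph n) (A : {set 'I_n})
    (i k : nat) :
  crossed_from r H A i -> i <= k -> k < r -> (vertex A k).+1 < vertex A k.+1.
Proof.
case/exists_inP=> B _ /forallP crAB leik ltkr.
by have := crAB (Ordinal ltkr); rewrite /= ltnNge leik /=; lia.
Qed.

(** A witness for [B] also serves [A]: its [i]-th vertex is that of [B], which lies strictly between
    the [i]-th and next vertices of [A]. *)
Lemma crossed_from_pred (n r : nat) (H : hypergraph n) (A B : {set 'I_n})
    (i : nat) :
    #|B| = r -> i < r -> crossed_from r H B i.+1 ->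
    (forall k, k <= r -> k != i -> vertex A k = vertex B k) ->
    vertex A i < vertex B i ->
  crossed_from r H A i.
Proof.
move=> cB ltir /exists_inP[C CH /forallP crBC] eqAB ltAB.
apply/exists_inP; exists C => //; apply/forallP => k.
have ltkr := ltn_ord k; have := crBC k; rewrite ltnS.
case: (ltngtP k i) => [ltki|ltik|eqki].
- by rewrite eqAB; lia.
- by rewrite !eqAB; lia.
by rewrite eqki => /eqP->; rewrite ltAB eqAB ?vertex_ltS ?cB //; lia.
Qed.

Section PushVertex.

Variables (n r i : nat) (A : {set 'I_n}).
Hypotheses (cA : #|A| = r) (ltir : i < r).

Let g k := if k == i then (vertex A i.+1).-1 else vertex A k.

Let gS k : k < r -> g k < g k.+1.
Proof.
move=> ltkr; rewrite /g; have vS := @vertex_ltS _ A; rewrite cA in vS.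
have := vS k ltkr; have := vS i ltir.
case: (eqVneq k i) => [->|neki]; first by rewrite (_ : i.+1 == i = false); lia.
by case: (eqVneq k.+1 i) => // <-; lia.
Qed.

Let gr : g r = n.
Proof. by rewrite /g gtn_eqF // -cA vertex_card. Qed.

Lemma card_push_vertex : #|push_vertex r A i| = r.
Proof. exact: (card_set_of_fun gS gr). Qed.

Lemma vertex_push (k : nat) : k <= r ->
  vertex (push_vertex r A i) k =
    if k == i then (vertex A i.+1).-1 else vertex A k.
Proof. exact: (vertex_set_of_fun gS gr). Qed.

Lemma push_vertex_nogap :
  vertex (push_vertex r A i) i.+1 = (vertex (push_vertex r A i) i).+1.
Proof.
rewrite !vertex_push ?(ltnW ltir) // eqxx (_ : i.+1 == i = false); last by lia.
by rewrite prednK // (leq_ltn_trans _ (vertex_ltS _)) ?cA.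
Qed.

End PushVertex.

Lemma card_cross_free (n r : nat) (H : hypergraph n) :
    uniform r H -> ~~ ord_contains (crossing_matching r) H ->
  #|H| <= #|nonsparse_sets n r|.
Proof.
move=> uH freeH.
have cH A : A \in H -> #|A| = r by move=> AH; apply/eqP/(forall_inP uH).
pose stop A (i : nat) := crossed_from r H A i.+1 && ~~ crossed_from r H A i.
(* The default 0 is never reached on edges of [H], by [idxP]. *)
pose idx A : nat := odflt 0 (omap val [pick i : 'I_r | stop A i]).
have idxP A : A \in H -> idx A < r /\ stop A (idx A).
  move=> AH; rewrite /idx; case: pickP => /= [i|no]; first by split.
  have [i] : exists i : 'I_r, stop A i.
    apply: exists_crossing_index => //; apply: contra freeH.
    exact: crossed_from0_contains.
  by rewrite no.
pose phi A := push_vertex r A (idx A).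
have gap A k : A \in H -> idx A < k -> k < r ->
    (vertex (phi A) k).+1 < vertex (phi A) k.+1.
  move=> AH ltik ltkr; have [ltir /andP[crA _]] := idxP A AH.
  rewrite !vertex_push ?(ltnW ltkr) ?cH // !gtn_eqF //; last exact: ltnW.
  exact: crossed_from_gap crA _ _.
rewrite -(card_in_imset (f := phi)).
  apply/subset_leq_card/subsetP => _ /imsetP[A AH ->].
  have [ltir _] := idxP A AH.
  rewrite inE card_push_vertex ?cH // eqxx; apply/forallPn.
  by exists (Ordinal ltir); rewrite /= push_vertex_nogap ?cH // ltnn.
move=> A B AH BH eqAB.
have [ltiA /andP[crA ncrA]] := idxP A AH.
have [ltiB /andP[crB ncrB]] := idxP B BH.
(* The larger of two distinct indices would be a gap of one image and not of the other. *)
have eqi : idx A = idx B.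
  apply/eqP; case: ltngtP => // lti.
    have := gap A _ AH lti ltiB; rewrite eqAB push_vertex_nogap ?cH //.
    by rewrite ltnn.
  have := gap B _ BH lti ltiA; rewrite -eqAB push_vertex_nogap ?cH //.
  by rewrite ltnn.
have eqv k : k <= r -> k != idx A -> vertex A k = vertex B k.
  move=> lekr /negPf neki; have := congr1 (fun E => vertex E k) eqAB.
  by rewrite !vertex_push ?cH // -eqi neki.
have [ltv|ltv|eqvi] := ltngtP (vertex A (idx A)) (vertex B (idx A)).
- by rewrite (crossed_from_pred (cH B BH) ltiA _ eqv) // eqi in ncrA.
- rewrite -eqi in ncrB.
  rewrite (crossed_from_pred (cH A AH) ltiA crA _ ltv) // in ncrB.
  by move=> k lekr neki; rewrite eqv.
apply: (vertex_inj (cH A AH) (cH B BH)) => k ltkr.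
by have [->|neki] := eqVneq k (idx A); last exact: eqv (ltnW ltkr) neki.
Qed.

(** * The cyclic setting and the lower bound *)

Lemma ord_contains_cg (m n : nat) (F : hypergraph m) (H : hypergraph n) :
  ord_contains F H -> cg_contains F H.
Proof.
case/existsP=> f /andP[/andP[injf /forallP monof] mapf].
have {}monof (a b : 'I_m) : a < b -> f a < f b.
  by move/forallP/(_ b)/implyP: (monof a).
apply/existsP; exists f; rewrite /cyclic_embedding injf mapf andbT /=.
apply/forallP => a; apply/forallP => b; apply/forallP => c; apply/implyP.
by case/or3P => /andP[/monof ltab /monof ltbc]; rewrite /cyclic_lt ltab ltbc ?orbT.
Qed.

(** In a cyclic embedding of a crossing matching an odd vertex follows each even
    one and conversely, hence no two consecutive vertices lie in one edge. *)
Lemma crossing_edge_last (n r : nat) (f : 'I_(2 * r) -> 'I_n) (b : bool) :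
    cyclic_embedding f ->
    f @: [set i : 'I_(2 * r) | odd i == b] \in nonsparse_sets n r ->
  exists2 i : 'I_(2 * r), odd i = b & (f i).+1 = n.
Proof.
case/andP=> _ /forallP cycf; set A := f @: _.
rewrite inE => /andP[/eqP cA /forallPn[k]]; rewrite -leqNgt => lev.
have ltkr := ltn_ord k.
have [x xA vx] : exists2 x, x \in A & val x = vertex A k.
  by apply: vertex_in; rewrite cA.
have vS : vertex A k.+1 = (val x).+1.
  have := @vertex_ltS _ A k; rewrite cA => /(_ ltkr); lia.
case/imsetP: xA => i; rewrite inE => /eqP oi xE.
(* If [k] is the last index, the successor of [x] is the sentinel [n]. *)
have [ltSk|leSk] := ltnP k.+1 r; last first.
  exists i; rewrite // -xE -vS (_ : k.+1 = #|A|) ?vertex_card //.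
  by rewrite cA; apply/eqP; rewrite eqn_leq leSk ltkr.
have [y yA vy] : exists2 y, y \in A & val y = vertex A k.+1.
  by apply: vertex_in; rewrite cA.
case/imsetP: yA => j; rewrite inE => /eqP oj yE.
have neij : i != j :> nat.
  apply/eqP => /val_inj eqij.
  by move: vy; rewrite vS yE -eqij -xE; lia.
(* Take the cyclic successor of [i]: since [2 * r] is even, its parity differs from that of [i] and
   [j], so it is not [j]. *)
have [c cyc] : exists c : 'I_(2 * r), cyclic_lt i c j.
  have := ltn_ord i; have := ltn_ord j => ltj lti.
  have [ltc|gec] := ltnP i.+1 (2 * r).
    by exists (Ordinal ltc); rewrite /cyclic_lt /=; lia.
  have lt0 : 0 < 2 * r by lia.
  by exists (Ordinal lt0); rewrite /cyclic_lt /=; lia.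
(* As [f j] is [f i] plus 1, there is no room for [f c] between them, and the other two rotations
   need [f j < f i]. *)
move/forallP/(_ c)/forallP/(_ j)/implyP/(_ cyc): (cycf i).
by rewrite /cyclic_lt -xE -yE; move: vy => /=; rewrite vS /=; lia.
Qed.

Lemma nonsparse_sets_cross_free (n r : nat) :
  ~~ cg_contains (crossing_matching r) (nonsparse_sets n r).
Proof.
apply/existsP => -[f /andP[cycf /forall_inP mapf]].
have mapb (b : bool) :
    f @: [set i : 'I_(2 * r) | odd i == b] \in nonsparse_sets n r.
  apply: mapf; rewrite !inE; case: b; [apply/orP; right|apply/orP; left].
    by apply/eqP/setP => i; rewrite !inE eqb_id.
  by apply/eqP/setP => i; rewrite !inE eqbF_neg.
have [i oi fi] := crossing_edge_last cycf (mapb false).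
have [j oj fj] := crossing_edge_last cycf (mapb true).
case/andP: cycf => /injectiveP injf _.
have eqij : i = j by apply/injf/val_inj/succn_inj; rewrite fi fj.
by rewrite eqij oj in oi.
Qed.

Theorem corollary2p5 (n r : nat) (hr : 1 < r) (hn : r < n) :
  ex_ord r n (crossing_matching r) = ex_cg r n (crossing_matching r) /\
  ex_cg r n (crossing_matching r) = 'C(n, r) - 'C(n - r, r).
Proof.
rewrite -(card_nonsparse_sets (ltnW hn)).
(* The three numbers are bounded by one another in a circle; cyclic freeness is the stronger
   condition, so [ex_cg] is at most [ex_ord]. *)
have ord_le : ex_ord r n (crossing_matching r) <= #|nonsparse_sets n r|.
  by apply/bigmax_leqP => H /andP[]; apply: card_cross_free.
have cg_le : ex_cg r n (crossing_matching r) <= ex_ord r n (crossing_matching r).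
  apply/bigmax_leqP => H /andP[uH freeH]; apply: leq_bigmax_cond.
  by rewrite uH; apply: contra freeH; apply: ord_contains_cg.
have cg_ge : #|nonsparse_sets n r| <= ex_cg r n (crossing_matching r).
  apply: leq_bigmax_cond; rewrite nonsparse_sets_cross_free andbT.
  by apply/forall_inP => A; rewrite inE => /andP[].
by split; apply/eqP; rewrite eqn_leq; lia.
Qed.
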